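(* Let $\delta=a_{12}a_{13}a_{23}$. The singular pure braid group $SP_3$ is generated by the elements $$\delta,\ a_{13},\ a_{23},\ b_{12},\ b_{13},\ b_{23}$$ and is defined by the following relations (i.e. these generators and relations form a presentation of $SP_3$): $$\delta b_{12}=b_{12}\delta,\quad \delta a_{13}=a_{13}\delta,\quad \delta a_{23}=a_{23}\delta,\quad \delta b_{13}=b_{13}\delta,\quad \delta b_{23}=b_{23}\delta,$$ $$a_{13}b_{13}=b_{13}a_{13},\quad a_{23}b_{23}=b_{23}a_{23},\quad b_{12}(a_{13}a_{23})b_{12}^{-1}=a_{13}a_{23}.$$
   Context: The singular braid group $SG_3$ is the group with generators $\sigma_1,\sigma_2,\tau_1,\tau_2$ and defining relations $$\sigma_1\sigma_2\sigma_1=\sigma_2\sigma_1\sigma_2,\quad \sigma_1\tau_1=\tau_1\sigma_1,\quad \sigma_2\tau_2=\tau_2\sigma_2,\quad \sigma_1\sigma_2\tau_1=\tau_2\sigma_1\sigma_2,\quad \sigma_2\sigma_1\tau_2=\tau_1\sigma_2\sigma_1.$$ The singular pure braid group $SP_3$ is the kernel of the homomorphism $\pi:SG_3\to S_3$ onto the symmetric group with $\pi(\sigma_i)=\pi(\tau_i)=(i,i+1)$ for $i=1,2$. The following elements of $SP_3$ are used: $$a_{12}=\sigma_1^2,\quad a_{13}=\sigma_2\sigma_1^2\sigma_2^{-1},\quad a_{23}=\sigma_2^2,\quad b_{12}=\sigma_1\tau_1,\quad b_{13}=\sigma_2\sigma_1\tau_1\sigma_2^{-1},\quad b_{23}=\sigma_2\tau_2.$$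 *)

(* Defs.v *)
From HB Require Import structures.
From mathcomp Require Import all_boot all_fingroup.
From mathcomp Require Import generic_quotient boolp.

Set Implicit Arguments.
Unset Strict Implicit.
Unset Printing Implicit Defensive.

Local Open Scope group_scope.
Local Open Scope quotient_scope.

Section FreeGroup.
Variable I : choiceType.

(* The letter (i, false) stands for the generator i, (i, true) for its
   inverse. *)
Local Notation letter := (I * bool)%type.
Local Notation word := (seq letter).

Definition letterV (l : letter) : letter := (l.1, ~~ l.2).
Definition wordV (w : word) : word := rev (map letterV w).

Inductive word_eq : word -> word -> Prop :=
| word_eq_refl u : word_eq u u
| word_eq_sym u v : word_eq u v -> word_eq v u
| word_eq_trans u v w : word_eq u v -> word_eq v w -> word_eq u w
| word_eq_cancel u l v : word_eq (u ++ l :: letterV l :: v) (u ++ v).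

Definition word_eqb : rel word := fun u v => `[< word_eq u v >].

Lemma word_eqb_refl : reflexive word_eqb.
Proof. by move=> u; apply/asboolP; exact: word_eq_refl. Qed.

Lemma word_eqb_sym : symmetric word_eqb.
Proof. by move=> u v; apply/asboolP/asboolP => ?; exact: word_eq_sym. Qed.

Lemma word_eqb_trans : transitive word_eqb.
Proof.
by move=> v u w /asboolP uv /asboolP vw; apply/asboolP/(word_eq_trans uv vw).
Qed.

Canonical word_equiv :=
  EquivRel word_eqb word_eqb_refl word_eqb_sym word_eqb_trans.

Definition freeGroup := {eq_quot word_equiv}.
HB.instance Definition _ := Choice.on freeGroup.
HB.instance Definition _ := EqQuotient.on freeGroup.

Local Notation fcl := (\pi_freeGroup).

Lemma freeGroupP (u v : word) :
  fcl u = fcl v <-> word_eq u v.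
Proof.
by split=> [/eqmodP /asboolP //|uv]; apply/eqmodP/asboolP.
Qed.

Lemma freeGroupW (P : freeGroup -> Prop) :
  (forall w, P (fcl w)) -> forall x, P x.
Proof. exact: quotW. Qed.

Lemma word_eq_catr t u v : word_eq u v -> word_eq (u ++ t) (v ++ t).
Proof.
elim=> {u v} [u|u v _|u v w _ IHu _|u l v].
- exact: word_eq_refl.
- by move=> ?; exact: word_eq_sym.
- by move=> IHv; exact: word_eq_trans IHu IHv.
- by rewrite -!catA /=; exact: word_eq_cancel.
Qed.

Lemma word_eq_catl t u v : word_eq u v -> word_eq (t ++ u) (t ++ v).
Proof.
elim=> {u v} [u|u v _|u v w _ IHu _|u l v].
- exact: word_eq_refl.
- by move=> ?; exact: word_eq_sym.
- by move=> IHv; exact: word_eq_trans IHu IHv.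
- by rewrite !catA; exact: word_eq_cancel.
Qed.

Lemma letterVK : involutive letterV.
Proof. by case=> i b; rewrite /letterV /= negbK. Qed.

Lemma wordV_cat u v : wordV (u ++ v) = wordV v ++ wordV u.
Proof. by rewrite /wordV map_cat rev_cat. Qed.

Lemma wordVK : involutive wordV.
Proof. by move=> w; rewrite /wordV map_rev revK mapK //; exact: letterVK. Qed.

Lemma wordV_eq u v : word_eq u v -> word_eq (wordV u) (wordV v).
Proof.
elim=> {u v} [u|u v _|u v w _ IHu _|u l v].
- exact: word_eq_refl.
- by move=> ?; exact: word_eq_sym.
- by move=> IHv; exact: word_eq_trans IHu IHv.
- rewrite !wordV_cat -cat1s -(cat1s (letterV l)) !wordV_cat /wordV /= -!catA /=.
  by rewrite letterVK; exact: word_eq_cancel.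
Qed.

Lemma word_eqVl w : word_eq (wordV w ++ w) [::].
Proof.
elim: w => [|l w IHw]; first exact: word_eq_refl.
rewrite -cat1s wordV_cat -catA /=; apply: word_eq_trans IHw.
by rewrite /wordV /= -{2}(letterVK l); exact: word_eq_cancel.
Qed.

Definition freeGroup_one : freeGroup := fcl [::].
Definition freeGroup_mul (x y : freeGroup) : freeGroup :=
  fcl (repr x ++ repr y).
Definition freeGroup_inv (x : freeGroup) : freeGroup := fcl (wordV (repr x)).

Lemma freeGroup_mulE u v :
  freeGroup_mul (fcl u) (fcl v) = fcl (u ++ v).
Proof.
apply/freeGroupP; apply: (@word_eq_trans _ (u ++ repr (fcl v))).
  by apply: word_eq_catr; apply/freeGroupP; rewrite reprK.
by apply: word_eq_catl; apply/freeGroupP; rewrite reprK.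
Qed.

Lemma freeGroup_invE u : freeGroup_inv (fcl u) = fcl (wordV u).
Proof. by apply/freeGroupP/wordV_eq/freeGroupP; rewrite reprK. Qed.

Lemma freeGroup_mulA : associative freeGroup_mul.
Proof.
move=> x y z; elim/freeGroupW: x => u.
elim/freeGroupW: y => v; elim/freeGroupW: z => w.
by rewrite !freeGroup_mulE catA.
Qed.

Lemma freeGroup_mul1 : left_id freeGroup_one freeGroup_mul.
Proof. by move=> z; elim/freeGroupW: z => u; rewrite freeGroup_mulE. Qed.

Lemma freeGroup_mulr1 : right_id freeGroup_one freeGroup_mul.
Proof. by move=> z; elim/freeGroupW: z => u; rewrite freeGroup_mulE cats0. Qed.

Lemma freeGroup_mulV : left_inverse freeGroup_one freeGroup_inv freeGroup_mul.
Proof.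
move=> z; elim/freeGroupW: z => u; rewrite freeGroup_invE freeGroup_mulE.
exact/freeGroupP/word_eqVl.
Qed.

Lemma freeGroup_mulrV : right_inverse freeGroup_one freeGroup_inv freeGroup_mul.
Proof.
move=> z; elim/freeGroupW: z => u.
rewrite freeGroup_invE freeGroup_mulE -{1}(wordVK u).
exact/freeGroupP/word_eqVl.
Qed.

HB.instance Definition _ := isGroup.Build freeGroup freeGroup_mulA
  freeGroup_mul1 freeGroup_mulr1 freeGroup_mulV freeGroup_mulrV.

Definition fgen (i : I) : freeGroup := fcl [:: (i, false)].

Section Lift.
Variables (G : groupType) (x : I -> G).

Definition letter_eval (l : letter) : G := if l.2 then (x l.1)^-1 else x l.1.
Definition word_eval (w : word) : G := \prod_(l <- w) letter_eval l.
Definition freeGroup_lift (g : freeGroup) : G := word_eval (repr g).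

Lemma word_eval_eq u v : word_eq u v -> word_eval u = word_eval v.
Proof.
elim=> {u v} [//|u v _ -> //|u v w _ -> _ -> //|u l v].
rewrite /word_eval !big_cat !big_cons /=; congr (_ * _); rewrite mulgA.
by case: l => i [] /=; rewrite /letter_eval /= ?mulVg ?mulgV mul1g.
Qed.

Lemma freeGroup_liftE w : freeGroup_lift (fcl w) = word_eval w.
Proof. by apply/word_eval_eq/freeGroupP; rewrite reprK. Qed.

Lemma freeGroup_liftM : {morph freeGroup_lift : g h / g * h}.
Proof.
move=> z y; elim/freeGroupW: z => u.
elim/freeGroupW: y => v.
rewrite [_ * _]freeGroup_mulE !freeGroup_liftE.
by rewrite /word_eval big_cat.
Qed.

Lemma freeGroup_lift1 : freeGroup_lift 1 = 1.
Proof. by rewrite [LHS]freeGroup_liftE /word_eval big_nil. Qed.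

Lemma freeGroup_lift_gen i : freeGroup_lift (fgen i) = x i.
Proof. by rewrite freeGroup_liftE /word_eval big_seq1. Qed.

End Lift.
End FreeGroup.

HB.instance Definition _ (I : choiceType) (G : groupType) (x : I -> G) :=
  isMultiplicative.Build (freeGroup I) G (freeGroup_lift x)
    (freeGroup_liftM x).
HB.instance Definition _ (I : choiceType) (G : groupType) (x : I -> G) :=
  Multiplicative_isUMagmaMorphism.Build (freeGroup I) G
    (freeGroup_lift x) (freeGroup_lift1 x).

Section Presented.
Variables (I : choiceType).
(* The pair (u, v) stands for the relation u = v. *)
Variable rels : seq (freeGroup I * freeGroup I).

(* The normal closure of the relators u * v^-1. *)
Inductive relator_closure : freeGroup I -> Prop :=
| relator_closure_rel u v : (u, v) \in rels -> relator_closure (u * v^-1)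
| relator_closure1 : relator_closure 1
| relator_closureM g h :
    relator_closure g -> relator_closure h -> relator_closure (g * h)
| relator_closureV g : relator_closure g -> relator_closure g^-1
| relator_closureJ g h : relator_closure g -> relator_closure (h * g * h^-1).

Definition rel_eqb : rel (freeGroup I) :=
  fun g h => `[< relator_closure (g * h^-1) >].

Lemma rel_eqb_refl : reflexive rel_eqb.
Proof. by move=> g; apply/asboolP; rewrite mulgV; exact: relator_closure1. Qed.

Lemma rel_eqb_sym : symmetric rel_eqb.
Proof.
by move=> g h; apply/asboolP/asboolP => /relator_closureV; rewrite invMg invgK.
Qed.

Lemma rel_eqb_trans : transitive rel_eqb.
Proof.
move=> h g k /asboolP gh /asboolP /(relator_closureM gh).
by rewrite mulgA mulgVK => ?; apply/asboolP.
Qed.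

Canonical rel_equiv := EquivRel rel_eqb rel_eqb_refl rel_eqb_sym rel_eqb_trans.

Definition presGroup := {eq_quot rel_equiv}.
HB.instance Definition _ := Choice.on presGroup.
HB.instance Definition _ := EqQuotient.on presGroup.

Local Notation pcl := (\pi_presGroup).

Lemma presGroupP (g h : freeGroup I) :
  pcl g = pcl h <-> relator_closure (g * h^-1).
Proof.
by split=> [/eqmodP /asboolP //|uv]; apply/eqmodP/asboolP.
Qed.

Lemma presGroupW (P : presGroup -> Prop) :
  (forall g, P (pcl g)) -> forall x, P x.
Proof. exact: quotW. Qed.

Definition presGroup_one : presGroup := pcl 1.
Definition presGroup_mul (x y : presGroup) : presGroup := pcl (repr x * repr y).
Definition presGroup_inv (x : presGroup) : presGroup := pcl (repr x)^-1.

Lemma presGroup_mulE g h : presGroup_mul (pcl g) (pcl h) = pcl (g * h).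
Proof.
rewrite /presGroup_mul; set g' := repr _; set h' := repr _.
have gg : relator_closure (g' * g^-1) by apply/presGroupP; rewrite reprK.
have hh : relator_closure (h' * h^-1) by apply/presGroupP; rewrite reprK.
apply/presGroupP.
have := relator_closureM (relator_closureJ g' hh) gg.
by rewrite invMg !mulgA mulgVK.
Qed.

Lemma presGroup_invE g : presGroup_inv (pcl g) = pcl g^-1.
Proof.
rewrite /presGroup_inv; set g' := repr _.
have gg : relator_closure (g' * g^-1) by apply/presGroupP; rewrite reprK.
apply/presGroupP.
have := relator_closureJ g^-1 (relator_closureV gg).
by rewrite invMg !invgK !mulgA mulVg mul1g.
Qed.

Lemma presGroup_mulA : associative presGroup_mul.
Proof.
move=> x y z; elim/presGroupW: x => g.
elim/presGroupW: y => h; elim/presGroupW: z => k.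
by rewrite !presGroup_mulE mulgA.
Qed.

Lemma presGroup_mul1 : left_id presGroup_one presGroup_mul.
Proof. by move=> z; elim/presGroupW: z => g; rewrite presGroup_mulE mul1g. Qed.

Lemma presGroup_mulr1 : right_id presGroup_one presGroup_mul.
Proof. by move=> z; elim/presGroupW: z => g; rewrite presGroup_mulE mulg1. Qed.

Lemma presGroup_mulV : left_inverse presGroup_one presGroup_inv presGroup_mul.
Proof.
by move=> z; elim/presGroupW: z => g; rewrite presGroup_invE presGroup_mulE mulVg.
Qed.

Lemma presGroup_mulrV : right_inverse presGroup_one presGroup_inv presGroup_mul.
Proof.
by move=> z; elim/presGroupW: z => g; rewrite presGroup_invE presGroup_mulE mulgV.
Qed.

HB.instance Definition _ := isGroup.Build presGroup presGroup_mulA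
  presGroup_mul1 presGroup_mulr1 presGroup_mulV presGroup_mulrV.

Definition pgen (i : I) : presGroup := pcl (fgen i).

Section Lift.
Variables (G : groupType) (x : I -> G).

Definition satisfies : Prop :=
  {in rels, forall r, freeGroup_lift x r.1 = freeGroup_lift x r.2}.

Hypothesis xP : satisfies.

Definition presGroup_lift of satisfies : presGroup -> G :=
  fun g => freeGroup_lift x (repr g).

Lemma relator_closure_lift g : relator_closure g -> freeGroup_lift x g = 1.
Proof.
elim=> {g} [u v /xP /= uv||g h _ eg _ eh|g _ eg|g h _ eg].
- by rewrite gmulfF /= uv mulgV.
- exact: gmulf1.
- by rewrite gmulfM /= eg eh mulg1.
- by rewrite gmulfV /= eg invg1.
- by rewrite !gmulfM gmulfV /= eg mulg1 mulgV.
Qed.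

Lemma presGroup_liftE g : presGroup_lift xP (pcl g) = freeGroup_lift x g.
Proof.
apply/eqP; rewrite -divg_eq1 -gmulfF.
by apply/eqP/relator_closure_lift/presGroupP; rewrite reprK.
Qed.

Lemma presGroup_liftM : {morph presGroup_lift xP : g h / g * h}.
Proof.
move=> z y; elim/presGroupW: z => g.
elim/presGroupW: y => h.
by rewrite [_ * _]presGroup_mulE !presGroup_liftE gmulfM.
Qed.

Lemma presGroup_lift1 : presGroup_lift xP 1 = 1.
Proof. by rewrite [LHS]presGroup_liftE gmulf1. Qed.

Lemma presGroup_lift_gen i : presGroup_lift xP (pgen i) = x i.
Proof. by rewrite presGroup_liftE freeGroup_lift_gen. Qed.

End Lift.
End Presented.

HB.instance Definition _ (I : choiceType) rels (G : groupType) (x : I -> G)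
    (xP : satisfies rels x) :=
  isMultiplicative.Build (presGroup rels) G (presGroup_lift xP)
    (presGroup_liftM xP).
HB.instance Definition _ (I : choiceType) rels (G : groupType) (x : I -> G)
    (xP : satisfies rels x) :=
  Multiplicative_isUMagmaMorphism.Build (presGroup rels) G
    (presGroup_lift xP) (presGroup_lift1 xP).

(* The canonical map from the presented group to G, sending the i-th generator
   to x i, exists and is an isomorphism. *)
Definition is_presentation (G : groupType) (I : choiceType) (x : I -> G)
    (rels : seq (freeGroup I * freeGroup I)) : Prop :=
  exists f : {multiplicative presGroup rels -> G},
    bijective f /\ forall i, f (pgen rels i) = x i.

Inductive SG3_idx : predArgType := Sigma1 | Sigma2 | Tau1 | Tau2.

Definition SG3_idx_code (i : SG3_idx) : 'I_4 :=
  match i with Sigma1 => inord 0 | Sigma2 => inord 1 | Tau1 => inord 2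
  | Tau2 => inord 3 end.
Definition SG3_idx_decode (n : 'I_4) : SG3_idx :=
  match val n with 0 => Sigma1 | 1 => Sigma2 | 2 => Tau1 | _ => Tau2 end.
Lemma SG3_idx_codeK : cancel SG3_idx_code SG3_idx_decode.
Proof. by case; rewrite /SG3_idx_decode /= inordK. Qed.
HB.instance Definition _ := Countable.copy SG3_idx (can_type SG3_idx_codeK).

Definition SG3_rels : seq (freeGroup SG3_idx * freeGroup SG3_idx) :=
  let s1 := fgen Sigma1 in let s2 := fgen Sigma2 in
  let t1 := fgen Tau1 in let t2 := fgen Tau2 in
  [:: (s1 * s2 * s1, s2 * s1 * s2);
      (s1 * t1, t1 * s1);
      (s2 * t2, t2 * s2);
      (s1 * s2 * t1, t2 * s1 * s2);
      (s2 * s1 * t2, t1 * s2 * s1)].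

Definition SG3 : groupType := presGroup SG3_rels.

Definition sigma1 : SG3 := pgen SG3_rels Sigma1.
Definition sigma2 : SG3 := pgen SG3_rels Sigma2.
Definition tau1 : SG3 := pgen SG3_rels Tau1.
Definition tau2 : SG3 := pgen SG3_rels Tau2.

(* The points 1, 2, 3 are the ordinals 0, 1, 2 of 'I_3. Permutations compose
   from left to right, which does not affect the kernel of SG3_perm. *)
Definition SG3_perm_gen (i : SG3_idx) : 'S_3 :=
  match i with
  | Sigma1 | Tau1 => tperm (inord 0) (inord 1)
  | Sigma2 | Tau2 => tperm (inord 1) (inord 2)
  end.

Lemma SG3_perm_satisfies : satisfies SG3_rels SG3_perm_gen.
Proof.
have braid (a b c : 'I_3) : a != b -> b != c -> a != c ->
    tperm a b * tperm b c * tperm a b = tperm b c * tperm a b * tperm b c.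
  move=> ab bc ac.
  have -> : tperm a b * tperm b c * tperm a b = tperm b c ^ tperm a b.
    by rewrite conjgE tpermV mulgA.
  have -> : tperm b c * tperm a b * tperm b c = tperm a b ^ tperm b c.
    by rewrite conjgE tpermV mulgA.
  by rewrite !tpermJ tpermL tpermR (tpermD ac bc) tpermD // eq_sym.
have e01 : inord 0 != inord 1 :> 'I_3 by rewrite -val_eqE /= !inordK.
have e12 : inord 1 != inord 2 :> 'I_3 by rewrite -val_eqE /= !inordK.
have e02 : inord 0 != inord 2 :> 'I_3 by rewrite -val_eqE /= !inordK.
have eb := braid _ _ _ e01 e12 e02.
move=> r; rewrite !inE => /or4P[|||/orP[]] /eqP -> /=;
  by rewrite !gmulfM /= !freeGroup_lift_gen /= ?eb.
Qed.

Definition SG3_perm : SG3 -> 'S_3 := presGroup_lift SG3_perm_satisfies.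

Lemma SG3_permM g h : SG3_perm (g * h) = SG3_perm g * SG3_perm h.
Proof. exact: gmulfM. Qed.

Lemma SG3_permV g : SG3_perm g^-1 = (SG3_perm g)^-1.
Proof. exact: gmulfV. Qed.

Lemma SG3_perm_genE i : SG3_perm (pgen SG3_rels i) = SG3_perm_gen i.
Proof. exact: presGroup_lift_gen. Qed.

Definition SG3_pure : pred SG3 := fun g => SG3_perm g == 1.

Lemma SG3_pure_closed : group_closed SG3_pure.
Proof.
split=> [|g h]; rewrite !unfold_in /SG3_pure /SG3_perm ?gmulf1 //.
by move=> /eqP eg /eqP eh; rewrite gmulfF /= eg eh divgg.
Qed.

(* The group structure on SP3 is the one inherited from SG3. *)
Definition SP3 : predArgType := {g : SG3 | SG3_pure g}.
HB.instance Definition _ := Choice.on SP3.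
HB.instance Definition _ := SubChoice.on SP3.
HB.instance Definition _ :=
  SubChoice_isSubGroup.Build SG3 SG3_pure SP3 SG3_pure_closed.

Fact a12_pure : SG3_pure (sigma1 ^+ 2).
Proof.
rewrite /SG3_pure ?expg2 !(SG3_permM, SG3_permV, SG3_perm_genE) /=.
by rewrite ?tpermV -?mulgA ?tpermKg tperm2.
Qed.

Fact a13_pure : SG3_pure (sigma2 * sigma1 ^+ 2 * sigma2^-1).
Proof.
rewrite /SG3_pure ?expg2 !(SG3_permM, SG3_permV, SG3_perm_genE) /=.
by rewrite ?tpermV -?mulgA ?tpermKg tperm2.
Qed.

Fact a23_pure : SG3_pure (sigma2 ^+ 2).
Proof.
rewrite /SG3_pure ?expg2 !(SG3_permM, SG3_permV, SG3_perm_genE) /=.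
by rewrite ?tpermV -?mulgA ?tpermKg tperm2.
Qed.

Fact b12_pure : SG3_pure (sigma1 * tau1).
Proof.
rewrite /SG3_pure ?expg2 !(SG3_permM, SG3_permV, SG3_perm_genE) /=.
by rewrite ?tpermV -?mulgA ?tpermKg tperm2.
Qed.

Fact b13_pure : SG3_pure (sigma2 * sigma1 * tau1 * sigma2^-1).
Proof.
rewrite /SG3_pure ?expg2 !(SG3_permM, SG3_permV, SG3_perm_genE) /=.
by rewrite ?tpermV -?mulgA ?tpermKg tperm2.
Qed.

Fact b23_pure : SG3_pure (sigma2 * tau2).
Proof.
rewrite /SG3_pure ?expg2 !(SG3_permM, SG3_permV, SG3_perm_genE) /=.
by rewrite ?tpermV -?mulgA ?tpermKg tperm2.
Qed.


Definition a12 : SP3 := Sub (sigma1 ^+ 2) a12_pure.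
Definition a13 : SP3 := Sub (sigma2 * sigma1 ^+ 2 * sigma2^-1) a13_pure.
Definition a23 : SP3 := Sub (sigma2 ^+ 2) a23_pure.
Definition b12 : SP3 := Sub (sigma1 * tau1) b12_pure.
Definition b13 : SP3 := Sub (sigma2 * sigma1 * tau1 * sigma2^-1) b13_pure.
Definition b23 : SP3 := Sub (sigma2 * tau2) b23_pure.
Definition delta : SP3 := a12 * a13 * a23.

Inductive SP3_idx : predArgType := Delta | A13 | A23 | B12 | B13 | B23.

Definition SP3_idx_code (i : SP3_idx) : 'I_6 :=
  match i with Delta => inord 0 | A13 => inord 1 | A23 => inord 2
  | B12 => inord 3 | B13 => inord 4 | B23 => inord 5 end.
Definition SP3_idx_decode (n : 'I_6) : SP3_idx :=
  match val n with 0 => Delta | 1 => A13 | 2 => A23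
  | 3 => B12 | 4 => B13 | _ => B23 end.
Lemma SP3_idx_codeK : cancel SP3_idx_code SP3_idx_decode.
Proof. by case; rewrite /SP3_idx_decode /= inordK. Qed.
HB.instance Definition _ := Countable.copy SP3_idx (can_type SP3_idx_codeK).

Definition SP3_gen (i : SP3_idx) : SP3 :=
  match i with
  | Delta => delta | A13 => a13 | A23 => a23
  | B12 => b12 | B13 => b13 | B23 => b23
  end.

(* Main.v *)
Require Import Defs.
From HB Require Import structures.
From mathcomp Require Import all_boot all_fingroup.

(** The theorem rests on the decomposition of SG_3 over its braid subgroup.
Once tau_2 is eliminated as a conjugate of tau_1, the relations other than the
braid relation say that b = sigma_1 tau_1 commutes with sigma_1 and with the
full twist (sigma_1 sigma_2 sigma_1)^2 ([SG3_satisfies_twisted]), so SG_3 is an HNN extension of the braid group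
B_3 with stable letter b.  Intersecting with SP_3 gives three stable letters
b_12, b_13, b_23 over P_3 = <delta> x F(a_13, a_23), each centralising delta
and the corresponding a_ij; since a_12 = delta (a_13 a_23)^-1, commuting with
a_12 becomes commuting with a_13 a_23.  These are the stated relations.

Normal forms in HNN extensions can be avoided.  Let P be the presented group.
Checking the relations in SP_3 gives a map from P to SP_3
([SP3_gen_satisfies]); the point there is that delta is the full twist, which
is central in SG_3 ([full_twist_central]).  For the inverse, the six
permutation braids form a transversal of SP_3 in SG_3, and the
Reidemeister-Schreier rewriting of (transversal element) * (generator) can be
performed in P.  It is recorded as a homomorphism from SG_3 to the wreath
product of P with the permutations of the six cosets, the Kaloujnine-Krasner
embedding read with coefficients in P ([SG3_wreath_satisfies]).  The
coordinate at the trivial coset, restricted to pure braids, is a homomorphism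
from SP_3 to P.  The cocycle identity [SG3_cocycle] makes it a right inverse
of the map from P to SP_3, and a computation on the six generators makes it a
left inverse. *)

Set Implicit Arguments.
Unset Strict Implicit.
Unset Printing Implicit Defensive.
Local Open Scope group_scope.

(** * Presented groups *)

Section PresentedGroups.
Variables (I : choiceType) (rels : seq (freeGroup I * freeGroup I)).

(** The quotient map is itself a lift, which turns statements about classes of
words into statements about products of generators and their inverses. *)
Lemma freeGroup_lift_pgen g :
  freeGroup_lift (pgen rels) g = \pi_(presGroup rels)%qT g.
Proof.
elim/freeGroupW: g => w.
pose cl u : presGroup rels := \pi_(presGroup rels)%qT (\pi_(freeGroup I)%qT u).
have clM u v : cl (u ++ v) = cl u * cl v.
  rewrite /cl [RHS]presGroup_mulE.
  by rewrite [X in _ = \pi_(presGroup rels)%qT X]freeGroup_mulE.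
have clV u : cl (wordV u) = (cl u)^-1.
  rewrite /cl [RHS]presGroup_invE.
  by rewrite [X in _ = \pi_(presGroup rels)%qT X]freeGroup_invE.
rewrite freeGroup_liftE /word_eval.
suff -> : \prod_(l <- w) letter_eval (pgen rels) l = cl w by [].
elim: w => [|[i b] w IHw]; rewrite ?big_nil // big_cons -cat1s clM IHw.
by congr (_ * _); case: b => //; rewrite (clV [:: (i, false)]).
Qed.

Lemma pgen_satisfies : satisfies rels (pgen rels).
Proof.
move=> [u v] uv; rewrite !freeGroup_lift_pgen.
by apply/presGroupP; exact: relator_closure_rel.
Qed.

Lemma presGroup_ind (Q : presGroup rels -> Prop) :
    Q 1 -> (forall g h, Q g -> Q h -> Q (g * h)) ->
    (forall g, Q g -> Q g^-1) -> (forall i, Q (pgen rels i)) ->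
  forall g, Q g.
Proof.
move=> Q1 QM QV Qgen g; elim/presGroupW: g => g; rewrite -freeGroup_lift_pgen.
apply: big_ind => // -[i []] _; rewrite /letter_eval /=; first exact: QV.
exact: Qgen.
Qed.

End PresentedGroups.

(** * The full twist of the three-strand braid group *)

Section BraidIdentities.
Variables (G : groupType) (s t : G).
Hypothesis braid : s * t * s = t * s * t.

Let braidA z : s * (t * (s * z)) = t * (s * (t * z)).
Proof. by rewrite !mulgA braid. Qed.

Definition full_twist := (s * t * s) * (s * t * s).

(* The half twist exchanges the two generators, so its square centralises
   them. *)
Let half_twist1 : s * t * s * s = t * (s * t * s).
Proof. by rewrite -!mulgA -braidA mulgA. Qed.

Let half_twist2 : s * t * s * t = s * (s * t * s).
Proof. by rewrite -!mulgA; congr (s * _); rewrite !mulgA -braid. Qed.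

Lemma full_twist_comm1 : commute full_twist s.
Proof.
by rewrite /commute /full_twist -mulgA half_twist1 [LHS]mulgA half_twist2 !mulgA.
Qed.

Lemma full_twist_comm2 : commute full_twist t.
Proof.
by rewrite /commute /full_twist -mulgA half_twist2 [LHS]mulgA half_twist1 !mulgA.
Qed.

(** With s, t the braid generators, the right-hand side is
a_12 a_13 a_23. *)
Lemma full_twist_pure :
  full_twist = s ^+ 2 * (t * s ^+ 2 * t^-1) * t ^+ 2.
Proof.
by rewrite /full_twist {2}braid !expg2 -!mulgA mulKg -braidA.
Qed.

(** In pure braid terms, conjugation by sigma_1 sends a_23 to
a_23^-1 a_13 a_23; this is the only rewriting below that leaves a
product of several a_ij. *)
Lemma braid_conj_a23 :
  s * t ^+ 2 = (t ^+ 2)^-1 * (t * s ^+ 2 * t^-1) * t ^+ 2 * s.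
Proof.
rewrite !expg2 invMg -!mulgA !mulKg; apply: (mulgI t); rewrite mulVKg -braidA.
by congr (s * _); rewrite !mulgA braid.
Qed.

End BraidIdentities.

(** * Wreath products with finite symmetric groups *)

Section Wreath.
Variables (X : finType) (P : groupType).

(** The pair (f, s) acts as a monomial matrix on the right of X-indexed rows:
row x goes to row s x with coefficient f x.  Permutations compose from left to
right, hence the shift by the first factor in the product. *)
Definition wreath := ({ffun X -> P} * {perm X})%type.
HB.instance Definition _ := Choice.on wreath.

Implicit Types u v w : wreath.

Definition wreath_one : wreath := ([ffun => 1], 1).
Definition wreath_mul u v : wreath :=
  ([ffun x => u.1 x * v.1 (u.2 x)], u.2 * v.2).
Definition wreath_inv u : wreath := ([ffun x => (u.1 (u.2^-1 x))^-1], u.2^-1).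

Lemma wreath_eq u v : u.1 =1 v.1 -> u.2 =1 v.2 -> u = v.
Proof. by case: u v => [f s] [g t] /= /ffunP -> /permP ->. Qed.

Lemma wreath_mulA : associative wreath_mul.
Proof.
by move=> u v w; apply: wreath_eq => x /=; rewrite ?ffunE /= ?permM ?mulgA.
Qed.

Lemma wreath_mul1 : left_id wreath_one wreath_mul.
Proof.
by move=> u; apply: wreath_eq => x /=; rewrite ?ffunE /= ?mul1g ?perm1.
Qed.

Lemma wreath_mulr1 : right_id wreath_one wreath_mul.
Proof. by move=> u; apply: wreath_eq => x /=; rewrite ?ffunE /= ?mulg1. Qed.

Lemma wreath_mulV : left_inverse wreath_one wreath_inv wreath_mul.
Proof. by move=> u; apply: wreath_eq => x /=; rewrite ?ffunE /= ?mulVg. Qed.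

Lemma wreath_mulrV : right_inverse wreath_one wreath_inv wreath_mul.
Proof.
by move=> u; apply: wreath_eq => x /=; rewrite ?ffunE /= ?permK mulgV.
Qed.

HB.instance Definition _ := isGroup.Build wreath wreath_mulA
  wreath_mul1 wreath_mulr1 wreath_mulV wreath_mulrV.

Lemma wreathM_fst u v x : (u * v).1 x = u.1 x * v.1 (u.2 x).
Proof. by rewrite [LHS]ffunE. Qed.

Lemma wreathM_snd u v x : (u * v).2 x = v.2 (u.2 x).
Proof. exact: permM. Qed.

Lemma wreathV_fst u x : u^-1.1 x = (u.1 (u.2^-1 x))^-1.
Proof. by rewrite [LHS]ffunE. Qed.

End Wreath.

(** * The six cosets of the pure braid group *)

(** The permutation braids 1, s1, s2, s1 s2, s2 s1, s1 s2 s1, named by the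
indices of their letters; they represent the right cosets of SP_3 in SG_3. *)
Inductive coset_rep : predArgType := W0 | W1 | W2 | W12 | W21 | W121.

Definition coset_rep_code (x : coset_rep) : 'I_6 :=
  match x with W0 => inord 0 | W1 => inord 1 | W2 => inord 2
  | W12 => inord 3 | W21 => inord 4 | W121 => inord 5 end.
Definition coset_rep_decode (n : 'I_6) : coset_rep :=
  match val n with 0 => W0 | 1 => W1 | 2 => W2
  | 3 => W12 | 4 => W21 | _ => W121 end.
Lemma coset_rep_codeK : cancel coset_rep_code coset_rep_decode.
Proof. by case; rewrite /coset_rep_decode /= inordK. Qed.
HB.instance Definition _ := Finite.copy coset_rep (can_type coset_rep_codeK).

(** Right multiplication of the cosets by sigma_1 and by sigma_2. *)
Definition coset_mul1 x :=
  match x with W0 => W1 | W1 => W0 | W2 => W21 | W21 => W2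
  | W12 => W121 | W121 => W12 end.
Definition coset_mul2 x :=
  match x with W0 => W2 | W2 => W0 | W1 => W12 | W12 => W1
  | W21 => W121 | W121 => W21 end.

Lemma coset_mul1K : involutive coset_mul1. Proof. by case. Qed.
Lemma coset_mul2K : involutive coset_mul2. Proof. by case. Qed.

Definition coset_perm1 : {perm coset_rep} := perm (inv_inj coset_mul1K).
Definition coset_perm2 : {perm coset_rep} := perm (inv_inj coset_mul2K).

(** * The relations of SG_3 and SP_3 in a group *)

Lemma SG3_satisfiesE (G : groupType) (x : SG3_idx -> G) :
  satisfies SG3_rels x <->
  let s := x Sigma1 in let t := x Sigma2 in
  let s' := x Tau1 in let t' := x Tau2 in
  [/\ s * t * s = t * s * t, commute s s', commute t t',
      s * t * s' = t' * s * t & t * s * t' = s' * t * s].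
Proof.
split=> [xP | [br c1 c2 r1 r2] r].
  by split; [have := xP (_, _) (mem_nth (1, 1) (isT : 0 < size SG3_rels))
    |have := xP (_, _) (mem_nth (1, 1) (isT : 1 < size SG3_rels))
    |have := xP (_, _) (mem_nth (1, 1) (isT : 2 < size SG3_rels))
    |have := xP (_, _) (mem_nth (1, 1) (isT : 3 < size SG3_rels))
    |have := xP (_, _) (mem_nth (1, 1) (isT : 4 < size SG3_rels))];
  rewrite /= !gmulfM /= !freeGroup_lift_gen.
by rewrite !inE => /or4P[|||/orP[]] /eqP -> /=;
  rewrite !gmulfM /= !freeGroup_lift_gen.
Qed.

(** The HNN form of SG_3: tau_2 is the conjugate of tau_1 by s1 s2, and this
conjugation takes sigma_1 to sigma_2, so the relation between sigma_2 and tau_2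
repeats the one between sigma_1 and tau_1.  The last relation says that tau_1
commutes with s2 s1 s1 s2, which is s1^-2 times the full twist. *)
Lemma SG3_satisfies_twisted (G : groupType) (x : SG3_idx -> G) (b : G) :
    x Sigma1 * x Sigma2 * x Sigma1 = x Sigma2 * x Sigma1 * x Sigma2 ->
    commute (x Sigma1) b -> commute (full_twist (x Sigma1) (x Sigma2)) b ->
    x Tau1 = (x Sigma1)^-1 * b ->
    x Tau2 = (x Sigma1 * x Sigma2) * x Tau1 * (x Sigma1 * x Sigma2)^-1 ->
  satisfies SG3_rels x.
Proof.
move=> br sb db e1 e2; apply/SG3_satisfiesE; move: br sb db e1 e2.
move: (x Sigma1) (x Sigma2) (x Tau1) (x Tau2) => s t s' t' br sb db e1 e2.
have ss' : commute s s'.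
  by rewrite e1; apply: commuteM => //; apply/commuteV/commute_refl.
have ds' : commute (full_twist s t) s'.
  rewrite e1; apply: commuteM => //; apply: commuteV.
  exact: full_twist_comm1.
have et : t * (s * t) = s * t * s by rewrite br mulgA.
have e2' : t' * (s * t) = s * t * s' by rewrite e2 mulgVK.
split=> //.
- apply: (mulIg (s * t)); rewrite -mulgA e2' mulgA et -mulgA ss'.
  by rewrite -[RHS]mulgA et [RHS]mulgA e2' !mulgA.
- by rewrite -e2' mulgA.
- apply: (mulIg (s * t)); rewrite -mulgA e2'.
  have dE : full_twist s t = s * s * (t * s * (s * t)).
    have brA z : s * (t * (s * z)) = t * (s * (t * z)) by rewrite !mulgA br.
    by rewrite /full_twist {2}br -!mulgA -brA.
  have : commute (t * s * (s * t)) s'.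
    rewrite -(mulKg (s * s) (_ * _)) -dE; apply/commute_sym/commuteM.
      by apply/commuteV/commuteM; exact: commute_sym.
    exact: commute_sym.
  by rewrite /commute !mulgA.
Qed.

Definition SP3_rels : seq (freeGroup SP3_idx * freeGroup SP3_idx) :=
  let d := fgen Delta in
  let x13 := fgen A13 in let x23 := fgen A23 in
  let y12 := fgen B12 in let y13 := fgen B13 in let y23 := fgen B23 in
  [:: (d * y12, y12 * d);
      (d * x13, x13 * d);
      (d * x23, x23 * d);
      (d * y13, y13 * d);
      (d * y23, y23 * d);
      (x13 * y13, y13 * x13);
      (x23 * y23, y23 * x23);
      (y12 * (x13 * x23) * y12^-1, x13 * x23)].

(** All eight relations are commutations, the last one in the guise of a
conjugation; in this form the closure properties of commutation apply. *)
Lemma SP3_satisfiesE (G : groupType) (x : SP3_idx -> G) :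
  satisfies SP3_rels x <->
  [/\ forall i, commute (x Delta) (x i), commute (x A13) (x B13),
      commute (x A23) (x B23) & commute (x B12) (x A13 * x A23)].
Proof.
split=> [xP | [cd c13 c23 c12] r].
  have rel n (ltn8 : n < size SP3_rels) := xP _ (mem_nth (1, 1) ltn8).
  split; first case.
  - exact: commute_refl.
  - by have := rel 1%N isT; rewrite /= !gmulfM /= !freeGroup_lift_gen.
  - by have := rel 2%N isT; rewrite /= !gmulfM /= !freeGroup_lift_gen.
  - by have := rel 0%N isT; rewrite /= !gmulfM /= !freeGroup_lift_gen.
  - by have := rel 3%N isT; rewrite /= !gmulfM /= !freeGroup_lift_gen.
  - by have := rel 4%N isT; rewrite /= !gmulfM /= !freeGroup_lift_gen.
  - by have := rel 5%N isT; rewrite /= !gmulfM /= !freeGroup_lift_gen.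
  - by have := rel 6%N isT; rewrite /= !gmulfM /= !freeGroup_lift_gen.
  have := rel 7%N isT; rewrite /= !gmulfM gmulfV /= !freeGroup_lift_gen => e.
  by rewrite /commute -[in RHS]e mulgVK.
rewrite !inE => /or4P[|||/or4P[|||/orP[]]] /eqP -> /=;
  rewrite !gmulfM ?gmulfV /= !freeGroup_lift_gen //; try exact: cd.
by rewrite c12 mulgK.
Qed.

(** * Reidemeister-Schreier rewriting with values in a group *)

Section Cocycle.
Variables (P : groupType) (x : SP3_idx -> P).
Hypothesis xP : satisfies SP3_rels x.

(* The missing generator a_12, kept as a variable determined by
   delta = a_12 a_13 a_23. *)
Variable x12 : P.
Hypothesis x12E : x12 * (x A13 * x A23) = x Delta.

(** If t_c denotes the representative of the coset c, the value at c is the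
pure braid t_c s t_(c s)^-1, written in the generators of P, for s = sigma_1,
sigma_2 and sigma_1 tau_1.  As sigma_1 tau_1 is pure, the last one is a
conjugate of b_12, the same one at c and at c sigma_1 since sigma_1 commutes
with sigma_1 tau_1. *)
Definition cocycle1 (c : coset_rep) : P :=
  match c with W1 => x12 | W21 => x A13 | W121 => x A23 | _ => 1 end.
Definition cocycle2 (c : coset_rep) : P :=
  match c with W2 => x A23 | W12 => (x A23)^-1 * x A13 * x A23
  | W121 => x12 | _ => 1 end.
Definition cocycle_b (c : coset_rep) : P :=
  match c with W0 | W1 => x B12 | W2 | W21 => x B13 | W12 | W121 => x B23 end.

Definition wreath1 : wreath coset_rep P := (finfun cocycle1, coset_perm1).
Definition wreath2 : wreath coset_rep P := (finfun cocycle2, coset_perm2).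
Definition wreath_b : wreath coset_rep P := (finfun cocycle_b, 1).

Definition SG3_wreath (i : SG3_idx) : wreath coset_rep P :=
  match i with
  | Sigma1 => wreath1
  | Sigma2 => wreath2
  | Tau1 => wreath1^-1 * wreath_b
  | Tau2 => wreath1 * wreath2 * (wreath1^-1 * wreath_b)
            * (wreath1 * wreath2)^-1
  end.

(** By [SG3_satisfies_twisted] three identities remain, each checked on the six
cosets.  The braid relation reduces to the cyclic forms of
a_12 a_13 a_23 = delta, commutation with sigma_1 to the commutation of each
a_ij with b_ij, and the full twist has the constant value delta, which is
central. *)
Lemma SG3_wreath_satisfies : satisfies SG3_rels SG3_wreath.
Proof.
have [cd c13 c23 c12] := (SP3_satisfiesE x).1 xP.
have x12_comm : commute x12 (x B12).
  rewrite -(mulgK (x A13 * x A23) x12) x12E; apply/commute_sym/commuteM.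
    exact/commute_sym/cd.
  exact: commuteV.
have e13 : x A13 * (x A23 * x12) = x Delta.
  rewrite mulgA; apply: (mulIg (x A13 * x A23)); rewrite -(mulgA (_ * _)) x12E.
  by apply/commute_sym/commuteM; exact: cd.
have e23 : x A23 * (x12 * x A13) = x Delta.
  by apply: (mulgI (x A13)); rewrite -cd -[in RHS]e13 !mulgA.
have e23' : x12 * x A13 = (x A23)^-1 * x Delta by rewrite -e23 mulKg.
pose wE := (@wreathM_fst, @wreathM_snd, @permE, @perm1, @ffunE).
apply: (SG3_satisfies_twisted (b := wreath_b)) => //=.
- by apply: wreath_eq; case; rewrite !wE /= ?(mul1g, mulg1) -?mulgA ?mulVKg;
    rewrite ?x12E ?e13 ?e23 ?e23'.
- by rewrite /commute; apply: wreath_eq; case; rewrite !wE /= ?(mul1g, mulg1).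
suff -> : full_twist wreath1 wreath2 = ([ffun => x Delta], 1).
  by rewrite /commute; apply: wreath_eq; case; rewrite !wE //=; exact: cd.
by apply: wreath_eq; case; rewrite !wE /= ?(mul1g, mulg1) -?mulgA ?mulVKg;
  rewrite ?x12E ?e13 ?e23.
Qed.

End Cocycle.

(** * The map from the presented group to SP_3 *)

Lemma SG3_ind (Q : SG3 -> Prop) :
    Q 1 -> (forall g h, Q g -> Q h -> Q (g * h)) ->
    (forall g, Q g -> Q g^-1) ->
    Q sigma1 -> Q sigma2 -> Q tau1 -> Q tau2 ->
  forall g, Q g.
Proof. by move=> Q1 QM QV *; apply: presGroup_ind => // -[]. Qed.

Lemma SG3_defining_relations :
  [/\ sigma1 * sigma2 * sigma1 = sigma2 * sigma1 * sigma2,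
      commute sigma1 tau1, commute sigma2 tau2,
      sigma1 * sigma2 * tau1 = tau2 * sigma1 * sigma2 &
      sigma2 * sigma1 * tau2 = tau1 * sigma2 * sigma1].
Proof. exact/SG3_satisfiesE/pgen_satisfies. Qed.

Lemma val_delta : val delta = full_twist sigma1 sigma2.
Proof.
have [br _ _ _ _] := SG3_defining_relations.
by rewrite !valM /= full_twist_pure.
Qed.

Lemma tau2E : tau2 = (sigma1 * sigma2) * tau1 * (sigma1 * sigma2)^-1.
Proof.
have [_ _ _ e _] := SG3_defining_relations.
by rewrite e -(mulgA tau2) mulgK.
Qed.

(** Together with b_13 = s2 b_12 s2^-1, this exhibits b_13 and b_23 as
conjugates of b_12 by representatives of cosets. *)
Lemma b23_conj :
  sigma1 * sigma2 * (sigma1 * tau1) = sigma2 * tau2 * (sigma1 * sigma2).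
Proof.
have [br _ _ e1 _] := SG3_defining_relations.
by rewrite mulgA br -!mulgA; congr (_ * _); rewrite !mulgA e1.
Qed.

(** The half twist exchanges tau_1 and tau_2 as well as sigma_1 and sigma_2, so
its square commutes with every generator. *)
Lemma full_twist_central g : commute (full_twist sigma1 sigma2) g.
Proof.
have [br c1 c2 e1 e2] := SG3_defining_relations.
have d1 := full_twist_comm1 br; have d2 := full_twist_comm2 br.
have h1 : sigma1 * sigma2 * sigma1 * tau1 = tau2 * (sigma1 * sigma2 * sigma1).
  by rewrite -mulgA c1 mulgA e1 !mulgA.
have h2 : sigma1 * sigma2 * sigma1 * tau2 = tau1 * (sigma1 * sigma2 * sigma1).
  by rewrite br -mulgA c2 mulgA e2 !mulgA.
have dt1 : commute (full_twist sigma1 sigma2) tau1.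
  by rewrite /commute /full_twist -mulgA h1 mulgA h2 !mulgA.
move: g; apply: SG3_ind => //; first exact: commute1.
- by move=> g h; exact: commuteM.
- by move=> g; exact: commuteV.
by rewrite tau2E; apply: commuteM; [|apply: commuteV];
  do ?apply: commuteM.
Qed.

Lemma SP3_gen_satisfies : satisfies SP3_rels SP3_gen.
Proof.
have [_ c1 c2 _ _] := SG3_defining_relations.
have c12 : commute (sigma1 ^+ 2) (sigma1 * tau1).
  by apply/commute_sym/commuteX/commute_sym/commuteM.
have cd g : commute delta g.
  have := full_twist_central (val g); rewrite -val_delta => dg.
  by apply: val_inj; rewrite !valM; exact: dg.
apply/SP3_satisfiesE; split=> /=.
- by move=> i; exact: cd.
(* a_13 and b_13 are the conjugates of a_12 and b_12 by sigma_2. *)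
- have conjM z g h : z * g * z^-1 * (z * h * z^-1) = z * (g * h) * z^-1 :> SG3.
    by rewrite !mulgA mulgVK.
  apply: val_inj; rewrite !valM /= -(mulgA sigma2 sigma1 tau1).
  by rewrite !conjM c12.
- apply: val_inj; rewrite !valM /=.
  exact/commute_sym/commuteX/commute_sym/commuteM.
have -> : a13 * a23 = a12^-1 * delta by rewrite /delta -mulgA mulKg.
apply: commuteM; last exact/commute_sym/cd.
by apply: commuteV; apply: val_inj; rewrite !valM /=.
Qed.

(** * The inverse map *)

Definition rep (c : coset_rep) : SG3 :=
  match c with W0 => 1 | W1 => sigma1 | W2 => sigma2
  | W12 => sigma1 * sigma2 | W21 => sigma2 * sigma1
  | W121 => sigma1 * sigma2 * sigma1 end.

(** The image in S_3 of each other representative moves the point at which it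
is evaluated. *)
Lemma rep_pure c : SG3_pure (rep c) -> c = W0.
Proof.
have e01 : (inord 0 == inord 1 :> 'I_3) = false by rewrite -val_eqE /= !inordK.
have e12 : (inord 1 == inord 2 :> 'I_3) = false by rewrite -val_eqE /= !inordK.
have e02 : (inord 0 == inord 2 :> 'I_3) = false by rewrite -val_eqE /= !inordK.
have e20 : (inord 2 == inord 0 :> 'I_3) = false by rewrite eq_sym.
case: c => // /eqP/permP p.
- have := p (inord 0); rewrite SG3_perm_genE !permE /= eqxx => /esym/eqP.
  by rewrite e01.
- have := p (inord 1); rewrite SG3_perm_genE !permE /= eqxx => /esym/eqP.
  by rewrite e12.
- have := p (inord 0); rewrite !SG3_permM !SG3_perm_genE !permE /= !permE /=.
  by rewrite !eqxx => /esym/eqP; rewrite e02.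
- have := p (inord 0); rewrite !SG3_permM !SG3_perm_genE !permE /= !permE /=.
  by rewrite e01 e02 eqxx => /esym/eqP; rewrite e01.
have := p (inord 0); rewrite !SG3_permM !SG3_perm_genE.
rewrite !permE /= !permE /= !permE /= !eqxx e20 eq_sym e12 => /esym/eqP.
by rewrite e02.
Qed.

Section Isomorphism.

Let P : groupType := presGroup SP3_rels.
Let x : SP3_idx -> P := pgen SP3_rels.
Let x12 : P := x Delta * (x A13 * x A23)^-1.

Let x12E : x12 * (x A13 * x A23) = x Delta.
Proof. exact: mulgVK. Qed.

Definition SP3_of_pres : UMagmaMorphism.type P SP3 :=
  presGroup_lift SP3_gen_satisfies.

Definition SG3_to_wreath : UMagmaMorphism.type SG3 (wreath coset_rep P) :=
  presGroup_lift (SG3_wreath_satisfies (@pgen_satisfies _ SP3_rels) x12E).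

Lemma SP3_of_pres_gen i : SP3_of_pres (x i) = SP3_gen i.
Proof. exact: presGroup_lift_gen. Qed.

Lemma SG3_to_wreath_gen i :
  SG3_to_wreath (pgen SG3_rels i) = SG3_wreath x x12 i.
Proof. exact: presGroup_lift_gen. Qed.

(** The wreath coordinates carry the genuine rewriting: pushed to SP_3, the
coefficient of g at c is t_c g t_(c g)^-1.  The identity is stable under
products and inverses, so that it is enough to compare values on sigma_1,
sigma_2 and sigma_1 tau_1. *)
Lemma SG3_cocycle g c :
  rep c * g = val (SP3_of_pres ((SG3_to_wreath g).1 c))
              * rep ((SG3_to_wreath g).2 c).
Proof.
(* Only multiplicativity and the values on generators matter; a variable is not
   unfolded by simplification. *)
move: SP3_of_pres SP3_of_pres_gen => f fE; move: g c.
pose Q g (u : wreath coset_rep P) := forall c : coset_rep,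
  rep c * g = val (f (u.1 c)) * rep (u.2 c) :> SG3.
have QM g h u v : Q g u -> Q h v -> Q (g * h) (u * v).
  move=> Qg Qh c; rewrite wreathM_fst wreathM_snd gmulfM valM.
  by rewrite mulgA Qg -mulgA Qh mulgA.
have QV g u : Q g u -> Q g^-1 u^-1.
  move=> Qg c; rewrite wreathV_fst !gmulfV.
  by apply: (mulIg g); rewrite mulgVK -mulgA Qg mulKg permKV.
have [br c1 _ _ _] := SG3_defining_relations.
have v1 : val (f 1) = 1 by rewrite !gmulf1.
have v12 : val (f x12) = sigma1 * sigma1.
  have -> : f x12 = a12; last by rewrite /= expg2.
  by rewrite gmulfF gmulfM !fE /= /delta -(mulgA a12) mulgK.
have v13 : val (f (x A13)) = sigma2 * (sigma1 * sigma1) * sigma2^-1.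
  by rewrite fE.
have v23 : val (f (x A23)) = sigma2 * sigma2 by rewrite fE.
have v13' : val (f ((x A23)^-1 * x A13 * x A23)) =
    (sigma2 * sigma2)^-1 * (sigma2 * (sigma1 * sigma1) * sigma2^-1)
    * (sigma2 * sigma2).
  by rewrite -v13 -v23 !gmulfM /= !gmulfV.
have Q1 : Q sigma1 (wreath1 x x12).
  move=> c; rewrite ffunE permE; case: c => /=;
    rewrite ?v1 ?v12 ?v13 ?v23 ?mul1g ?mulg1 ?mulgA ?mulgVK //.
  by rewrite br -!mulgA; congr (_ * _); rewrite !mulgA br.
have Q2 : Q sigma2 (wreath2 x x12).
  move=> c; rewrite ffunE permE; case: c => /=;
    rewrite ?v1 ?v12 ?v23 ?mul1g ?mulg1 //.
    by rewrite v13' -[LHS]mulgA -(expg2 sigma2) (braid_conj_a23 br) !expg2.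
  by rewrite -!mulgA; congr (_ * _); rewrite !mulgA br.
have c1' : commute sigma1 (sigma1 * tau1) by exact: commuteM.
have Qb : Q (sigma1 * tau1) (wreath_b x).
  move=> c; rewrite ffunE perm1; case: c => /=;
    rewrite ?fE /= ?mul1g ?mulg1 //.
  - by rewrite !mulgA mulgVK.
  - exact: b23_conj.
  - by rewrite -[LHS]mulgA c1' !mulgA mulgVK.
  - by rewrite -[LHS]mulgA c1' mulgA b23_conj !mulgA.
suff QP g : Q g (SG3_to_wreath g) by [].
have Qt1 : Q tau1 ((wreath1 x x12)^-1 * wreath_b x).
  by rewrite -(mulKg sigma1 tau1); exact/QM/Qb/QV.
move: g; apply: SG3_ind => [|g h Qg Qh|g Qg||||]; rewrite ?SG3_to_wreath_gen //.
- by move=> c; rewrite gmulf1 ffunE perm1 gmulf1 mulg1 mul1g.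
- by rewrite gmulfM; exact: QM.
- by rewrite gmulfV; exact: QV.
have Q12 := QM _ _ _ _ Q1 Q2.
by rewrite tau2E; exact: QM (QM _ _ _ _ Q12 Qt1) (QV _ _ Q12).
Qed.

(** A pure braid fixes the trivial coset: by the cocycle identity the
representative of the image coset is pure. *)
Lemma SG3_to_wreath_pure (g : SP3) : (SG3_to_wreath (val g)).2 W0 = W0.
Proof.
apply: rep_pure; have := SG3_cocycle (val g) W0; rewrite mul1g.
set h := SP3_of_pres _ => /(congr1 SG3_perm).
by rewrite SG3_permM (eqP (valP g)) (eqP (valP h)) mul1g => /esym/eqP.
Qed.

Definition pres_of_SP3 (g : SP3) : P := (SG3_to_wreath (val g)).1 W0.

(** The coordinate at a coset is multiplicative on the stabiliser of that coset,
and here pure braids stabilise the trivial one. *)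
Lemma pres_of_SP3M : {morph pres_of_SP3 : g h / g * h}.
Proof.
move=> g h.
by rewrite /pres_of_SP3 valM gmulfM wreathM_fst SG3_to_wreath_pure.
Qed.

Lemma pres_of_SP3_gen i : pres_of_SP3 (SP3_gen i) = x i.
Proof.
have wV1 y : coset_perm1^-1 y = coset_mul1 y.
  by apply: (canLR (permK _)); rewrite permE coset_mul1K.
have wV2 y : coset_perm2^-1 y = coset_mul2 y.
  by apply: (canLR (permK _)); rewrite permE coset_mul2K.
(* The rules for inverse permutations come first, because permE would unfold
   an inverse into an unusable form. *)
pose wE := (@wreathM_fst, @wreathM_snd, @wreathV_fst, wV1, wV2,
            @permE, @perm1, @ffunE).
have eb : SG3_to_wreath (sigma1 * tau1) = wreath_b x.
  by rewrite gmulfM !SG3_to_wreath_gen /= mulVKg.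
have P12 : pres_of_SP3 a12 = x12.
  by rewrite /pres_of_SP3 /= expg2 gmulfM SG3_to_wreath_gen !wE /= mul1g.
have P13 : pres_of_SP3 a13 = x A13.
  rewrite /pres_of_SP3 /= expg2 !gmulfM gmulfV !SG3_to_wreath_gen !wE /=.
  by rewrite !mul1g invg1 mulg1.
have P23 : pres_of_SP3 a23 = x A23.
  by rewrite /pres_of_SP3 /= expg2 gmulfM SG3_to_wreath_gen !wE /= mul1g.
case: i => //=.
- by rewrite !pres_of_SP3M P12 P13 P23 -mulgA x12E.
- by rewrite /pres_of_SP3 eb !wE.
- rewrite /pres_of_SP3 /= -(mulgA sigma2) !gmulfM gmulfV -gmulfM eb.
  by rewrite !SG3_to_wreath_gen !wE /= !mul1g invg1 mulg1.
rewrite /pres_of_SP3 /= -(mulgK (sigma1 * sigma2) (sigma2 * tau2)) -b23_conj.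
rewrite invMg !gmulfM !gmulfV !SG3_to_wreath_gen mulVKg !wE.
by rewrite /= !mul1g invg1 !mulg1.
Qed.

Lemma SP3_of_presK : cancel SP3_of_pres pres_of_SP3.
Proof.
have pV g : pres_of_SP3 g^-1 = (pres_of_SP3 g)^-1.
  apply: (mulgI (pres_of_SP3 g)); rewrite -pres_of_SP3M !mulgV.
  by rewrite /pres_of_SP3 !gmulf1 ffunE.
apply: presGroup_ind => [|g h Qg Qh|g Qg|i].
- by rewrite /pres_of_SP3 !gmulf1 ffunE.
- by rewrite gmulfM pres_of_SP3M Qg Qh.
- by rewrite gmulfV pV Qg.
by rewrite SP3_of_pres_gen pres_of_SP3_gen.
Qed.

Lemma pres_of_SP3K : cancel pres_of_SP3 SP3_of_pres.
Proof.
move=> g; apply: val_inj.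
by have := SG3_cocycle (val g) W0; rewrite SG3_to_wreath_pure mul1g mulg1.
Qed.

End Isomorphism.

Theorem theorem4p4 :
  let d := fgen Delta in
  let x13 := fgen A13 in let x23 := fgen A23 in
  let y12 := fgen B12 in let y13 := fgen B13 in let y23 := fgen B23 in
  is_presentation SP3_gen
    [:: (d * y12, y12 * d);
        (d * x13, x13 * d);
        (d * x23, x23 * d);
        (d * y13, y13 * d);
        (d * y23, y23 * d);
        (x13 * y13, y13 * x13);
        (x23 * y23, y23 * x23);
        (y12 * (x13 * x23) * y12^-1, x13 * x23)].
Proof.
exists SP3_of_pres; split; last exact: SP3_of_pres_gen.
exact: Bijective SP3_of_presK pres_of_SP3K.
Qed.
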